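(* Let $n=r+s$ with $0<r<n$, and let $M^{(3)}_{r,s}$ be the super vector space of complex $n$th order cubic $(r,s)$-supermatrices. The triple product of cubic supermatrices defined by $$(ABC)=\mathrm{Str}^{(j)}A\;(B\ast_j C)$$ satisfies the following identities for all cubic supermatrices $A,B,C,D,F\in M^{(3)}_{r,s}$: 1. $(AB(CDF))=(A(CBD)F)$; 2. $((ABC)DF)=(-1)^{bc}\,((ACB)DF)$, where $B,C$ are homogeneous of degrees $b,c$ respectively; 3. $(AB(CDF))=(CB(ADF))$.
   Context: A complex cubic matrix of order $n$ is a family $A=(A_{ijk})_{1\le i,j,k\le n}$ of complex numbers. For $1\le l\le n$ its $l$th section of orientation $(j)$ is the $n\times n$ matrix $A^{(j)}_l=(A_{ilk})_{i,k}$ (second subscript fixed equal to $l$). The product relative to direction $(j)$, $A\ast_j B$, is the cubic matrix with sections $(A\ast_j B)^{(j)}_l=A^{(j)}_l\cdot B^{(j)}_l$ (ordinary matrix product) for $l=1,\ldots,n$. Cubic $(r,s)$-supermatrices, $r+s=n$: the index values $1,\ldots,r$ of the first subscript $i$ and of the third subscript $k$ are given parity $\bar 0$, and the values $r+1,\ldots,n$ are given parity $\bar 1$; the entry $A_{ijk}$ has parity equal to the sum of the parities of $i$ and $k$. Thus each section $A^{(j)}_l$ is a square $(r,s)$-supermatrix with even diagonal blocks of sizes $r\times r$ and $s\times s$ and odd off-diagonal blocks. $A$ is of even degree $\bar 0$ if all its odd-parity entries vanish, and of odd degree $\bar 1$ if all its even-parity entries vanish; $A$ is homogeneous if it is of even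 or odd degree. The supertrace relative to direction $(j)$ is $\mathrm{Str}^{(j)}A=\sum_{l=1}^n\mathrm{Str}\,A^{(j)}_l$, where $\mathrm{Str}$ of a square $(r,s)$-supermatrix is the trace of its upper-left $r\times r$ block minus the trace of its lower-right $s\times s$ block. *)

(* Defs.v *)
From HB Require Import structures.
From mathcomp Require Import all_boot all_order all_algebra.

Set Implicit Arguments.
Unset Strict Implicit.
Unset Printing Implicit Defensive.

Import GRing.Theory.
Local Open Scope ring_scope.

(* The entry A_ijk is [A (i, j, k)]. The codomain is the regular module K^o
   (convertible to K) so that the library's pointwise K-vector space structure
   on finite functions, and in particular [*:], applies. *)
Notation cubic K n := {ffun 'I_n * 'I_n * 'I_n -> K^o}.

Section Cubic.
Variable K : comNzRingType.

Definition section_j n (A : cubic K n) (l : 'I_n) : 'M[K]_n :=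
  \matrix_(i, k) A (i, l, k).

Definition mul_j n (A B : cubic K n) : cubic K n :=
  [ffun t => let: (i, l, k) := t in (section_j A l *m section_j B l) i k].

Section Super.
Variables r s : nat.

(* Parities and degrees are elements of Z/2, encoded as [bool] with [false] for
   0, [true] for 1 and [(+)] for the sum. Indices start at 0 here, so the odd
   index values are those [>= r]. *)
Definition index_parity (i : 'I_(r + s)) : bool := (r <= i)%N.

Definition entry_parity (i j k : 'I_(r + s)) : bool :=
  index_parity i (+) index_parity k.

Definition has_degree (A : cubic K (r + s)) (d : bool) : Prop :=
  forall i j k, entry_parity i j k != d -> A (i, j, k) = 0.

Definition supertrace (X : 'M[K]_(r + s)) : K :=
  \tr (ulsubmx X) - \tr (drsubmx X).

Definition supertrace_j (A : cubic K (r + s)) : K :=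
  \sum_(l < r + s) supertrace (section_j A l).

Definition triple (A B C : cubic K (r + s)) : cubic K (r + s) :=
  supertrace_j A *: mul_j B C.

End Super.
End Cubic.

(* Main.v *)
Require Import Defs.
From mathcomp Require Import all_boot all_order all_algebra.
From mathcomp Require Import reals complex.
Import GRing.Theory.
Local Open Scope ring_scope.
Local Open Scope complex_scope.

(** All three identities reduce to facts about the sections of orientation (j),
    which multiply independently of one another. The supertrace is linear and
    [mul_j] is bilinear, so a nested triple product is a product of two scalars
    times a [mul_j] product. In identities 1 and 3 every side is
    Str A * Str C times the product of B, D and F in this order: the former is
    associativity of [mul_j], the latter commutativity of the scalars. In
    identity 2 the two sides differ only in the scalars Str (B C) and
    Str (C B), and [supertrace_j_mulC] is the graded cyclicity of the
    supertrace, Str (B C) = (-1)^(bc) Str (C B), which holds section by section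
    because it holds monomial by monomial. *)

Section CubicAlgebra.
Variable K : comNzRingType.

Section Product.
Variable n : nat.
Implicit Types A B C : cubic K n.

Lemma section_jZ (a : K) A l : section_j (a *: A) l = a *: section_j A l.
Proof. by apply/matrixP=> i k; rewrite !mxE !ffunE. Qed.

Lemma section_j_mul A B l :
  section_j (mul_j A B) l = section_j A l *m section_j B l.
Proof. by apply/matrixP=> i k; rewrite !mxE ffunE mxE. Qed.

Lemma cubic_sectionP A B : section_j A =1 section_j B -> A = B.
Proof.
move=> eqAB; apply/ffunP=> -[[i l] k].
by have /matrixP/(_ i k) := eqAB l; rewrite !mxE.
Qed.

Lemma mul_jA A B C : mul_j A (mul_j B C) = mul_j (mul_j A B) C.
Proof. by apply: cubic_sectionP => l; rewrite !section_j_mul mulmxA. Qed.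

Lemma mul_jZl (a : K) A B : mul_j (a *: A) B = a *: mul_j A B.
Proof.
by apply: cubic_sectionP => l; rewrite section_jZ !section_j_mul section_jZ scalemxAl.
Qed.

Lemma mul_jZr (a : K) A B : mul_j A (a *: B) = a *: mul_j A B.
Proof.
by apply: cubic_sectionP => l; rewrite section_jZ !section_j_mul section_jZ scalemxAr.
Qed.

End Product.

Section Supertrace.
Variables r s : nat.
Implicit Types A B C D : cubic K (r + s).

(** Writing the block signs as powers of -1 turns the sign rule into a
    computation with exponents. *)
Lemma supertraceE (X : 'M[K]_(r + s)) :
  supertrace X = \sum_i (-1) ^+ index_parity i * X i i.
Proof.
rewrite /supertrace /mxtrace big_split_ord -sumrN /index_parity /=.
congr (_ + _); apply: eq_bigr => i _; rewrite !mxE.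
  by rewrite leqNgt ltn_ord mul1r.
by rewrite leq_addr mulN1r.
Qed.

Lemma supertrace_jZ (a : K) A : supertrace_j (a *: A) = a * supertrace_j A.
Proof.
rewrite /supertrace_j mulr_sumr; apply: eq_bigr => l _.
rewrite section_jZ !supertraceE mulr_sumr.
by apply: eq_bigr => i _; rewrite mxE mulrCA.
Qed.

(** In Str (B C) the monomial B_ilk C_kli carries the sign of i, in Str (C B)
    that of k. It can be nonzero only if b = c is the sum of the parities of i
    and k, and then these signs differ by (-1)^b = (-1)^(bc). *)
Lemma supertrace_j_mulC B C (b c : bool) :
    has_degree B b -> has_degree C c ->
  supertrace_j (mul_j B C) = (-1) ^+ (b * c)%N * supertrace_j (mul_j C B).
Proof.
move=> degB degC; rewrite /supertrace_j mulr_sumr; apply: eq_bigr => l _.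
rewrite !section_j_mul !supertraceE mulr_sumr.
under eq_bigr do rewrite mxE mulr_sumr.
rewrite exchange_big; apply: eq_bigr => k _ /=.
rewrite mxE !mulr_sumr; apply: eq_bigr => i _; rewrite !mxE.
have [Eb|nb] := eqVneq (entry_parity i l k) b; last first.
  by rewrite (degB _ _ _ nb) ?(mulr0, mul0r).
have [Ec|nc] := eqVneq (entry_parity k l i) c; last first.
  by rewrite (degC _ _ _ nc) ?(mulr0, mul0r).
rewrite [B _ * _]mulrC [RHS]mulrA -Eb -Ec /entry_parity.
by case: (index_parity i); case: (index_parity k);
   rewrite /= ?mulrNN ?mulr1 ?mul1r.
Qed.

Lemma triple_tripler A B C D F :
  triple A B (triple C D F) =
    (supertrace_j A * supertrace_j C) *: mul_j B (mul_j D F).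
Proof. by rewrite /triple mul_jZr scalerA. Qed.

End Supertrace.
End CubicAlgebra.

Theorem proposition6p1 (R : realType) (r s : nat)
  (hr : (0 < r)%N) (hrn : (r < r + s)%N)
  (A B C D F : cubic R[i] (r + s)) :
  [/\ triple A B (triple C D F) = triple A (triple C B D) F,
      forall b c : bool, has_degree B b -> has_degree C c ->
        triple (triple A B C) D F =
          (-1 : R[i]) ^+ (b * c)%N *: triple (triple A C B) D F
    & triple A B (triple C D F) = triple C B (triple A D F)].
Proof.
split=> [|b c degB degC|].
- by rewrite triple_tripler /triple mul_jZl scalerA mul_jA.
- by rewrite /triple !supertrace_jZ (supertrace_j_mulC _ _ _ _ _ _ _ degB degC) scalerA mulrCA.
- by rewrite !triple_tripler mulrC.
Qed.
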